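(* Let $a<b$, $r>0$, $c>1$, let $f,g:[0,1]\to[a,b]$ be $k$-step functions, and let $n_{r,c}=\frac{2k(b-a)^2}{(\sqrt c-1)r^2}$. Then for every integer $n\ge n_{r,c}$: (i) if $L_2(f,g)\le r$ then $\|vec_n(f)-vec_n(g)\|_2\le c^{1/4}r$; and (ii) if $L_2(f,g)>cr$ then $\|vec_n(f)-vec_n(g)\|_2>c^{3/4}r$.
   Context: A function $f:[0,1]\to\mathbb{R}$ is a $k$-step function if $[0,1]$ can be divided into $k$ sub-intervals on each of which $f$ is constant. $L_2(f,g)=\left(\int_0^1(f(x)-g(x))^2dx\right)^{1/2}$. For $\phi:[0,1]\to\mathbb{R}$ and $n\in\mathbb{N}$, $vec_n(\phi)=\left(\tfrac{1}{\sqrt n}\phi(\tfrac0n),\tfrac{1}{\sqrt n}\phi(\tfrac1n),\ldots,\tfrac{1}{\sqrt n}\phi(\tfrac{n-1}{n})\right)\in\mathbb{R}^n$, and $\|\cdot\|_2$ is the Euclidean norm. *)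

(* Defs.v *)
From HB Require Import structures.
From mathcomp Require Import all_boot all_order all_algebra.
From mathcomp Require Import all_classical all_reals all_analysis.
Import Order.TTheory GRing.Theory Num.Theory.
Import numFieldNormedType.Exports.

Set Implicit Arguments.
Unset Strict Implicit.
Unset Printing Implicit Defensive.

Local Open Scope classical_set_scope.
Local Open Scope ring_scope.

(* Functions on [0,1] are represented by functions R -> R; only their values
   on [0,1] are ever used. *)

(* The pieces are nonempty; they may be open, closed or half-open at either
   end, and may be reduced to a point. *)
Definition step_function (R : realType) (k : nat) (f : R -> R) : Prop :=
  exists I : 'I_k -> set R,
    [/\ partition [set: 'I_k] I `[0, 1],
        forall i, is_interval (I i) &
        forall i x y, I i x -> I i y -> f x = f y].

Definition L2dist (R : realType) (f g : R -> R) : R :=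
  Num.sqrt (\int[lebesgue_measure]_(x in `[0, 1]) (f x - g x) ^+ 2).

Definition vec (R : realType) (n : nat) (phi : R -> R) : 'rV[R]_n :=
  \row_(i < n) ((Num.sqrt n%:R)^-1 * phi (i%:R / n%:R)).

(* The norm the library puts on 'rV[R]_n is the sup norm, hence this one. *)
Definition euclidean_norm (R : realType) (n : nat) (v : 'rV[R]_n) : R :=
  Num.sqrt (\sum_(i < n) v ord0 i ^+ 2).

(* Main.v *)
(** The squared norm of [vec n f - vec n g] is the left-endpoint Riemann sum
    of [(f - g)^2] over the [n] cells [[i/n, (i+1)/n)].  A cell on which both
    [f] and [g] are constant contributes no error, any other at most
    [(b - a)^2 / n], and there are at most [2 k] of the latter.  So the squared
    norm is within [2 k (b - a)^2 / n <= (sqrt c - 1) r^2] of the squared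
    distance. *)

Require Import Defs.
From HB Require Import structures.
From mathcomp Require Import all_boot all_order all_algebra.
From mathcomp Require Import all_classical all_reals all_analysis.
From mathcomp Require Import ring lra.
Import Order.TTheory GRing.Theory Num.Theory.
Import numFieldNormedType.Exports.
Local Open Scope classical_set_scope.
Local Open Scope ring_scope.

(** On each piece [f] takes one value, so the piece either lies inside the preimage of [Y] or misses
    it. The preimage is therefore a finite union of intervals. *)
Lemma step_function_measurable {R : realType} {k : nat} {f : R -> R} :
  step_function k f -> measurable_fun (`[0, 1] : set R) f.
Proof.
move=> [I [[Icov _ _] Iitv Icst]] _ Y _.
have -> : `[0, 1] `&` f @^-1` Y = \bigcup_(i in [set: 'I_k]) (I i `&` f @^-1` Y).
  by rewrite -Icov /cover setI_bigcupl.
apply: fin_bigcup_measurable => // i _.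
have [[x [Ix Yfx]]|/set0P/negP/negPn/eqP->] := pselect (I i `&` f @^-1` Y !=set0); last by [].
have -> : I i `&` f @^-1` Y = I i.
  by apply/seteqP; split=> [y []//|y Iy]; split => //=; rewrite (Icst i y x).
exact: measurable_realfun.is_interval_measurable.
Qed.

(** Values are compared with the one at the left endpoint because that is the sample point of the
    Riemann sum. Cells are half-open, so a jump exactly at [(i + 1) / n] is not charged to cell
    [i]. *)
Definition nonconstant_cells {R : realType} (n : nat) (f : R -> R) : {set 'I_n} :=
  [set i : 'I_n | `[< exists2 x, x \in `[i%:R / n%:R, i.+1%:R / n%:R[ &
                                 f x <> f (i%:R / n%:R) >]].

Lemma grid_in01 {R : realType} {n i : nat} :
  (i <= n)%N -> i%:R / n%:R \in `[0 : R, 1].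
Proof.
move=> lein; rewrite in_itv /= divr_ge0 ?ler0n //=.
(* For [n = 0] the quotient is [0], because [0^-1 = 0] by convention. *)
have [->|n0] := posnP n; first by rewrite invr0 mulr0 ler01.
by rewrite ler_pdivrMr ?ltr0n // mul1r ler_nat.
Qed.

(* The piece containing [i / n] determines [i] when [f] is not constant on the
   [i]-th cell, since that piece ends before [(i + 1) / n]. *)
Lemma card_nonconstant_cells {R : realType} {k : nat} {f : R -> R} (n : nat) :
  step_function k f -> (#|nonconstant_cells n f| <= k)%N.
Proof.
move=> [I [[Icov _ _] Iitv Icst]].
have /choice[p Ip] : forall i : 'I_n, exists j, I j (i%:R / n%:R).
  move=> i; have : `[0 : R, 1]%classic (i%:R / n%:R) by exact/grid_in01/ltnW.
  by rewrite -Icov => -[j _ ?]; exists j.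
have sep (i j : 'I_n) : i \in nonconstant_cells n f -> p i = p j -> ~~ (i < j)%N.
  rewrite inE => /asboolP[x]; rewrite in_itv /= => /andP[ix xi] fx pij.
  apply/negP => ltij; apply: fx; apply: (Icst (p i)) => //.
  apply: (Iitv (p i) (i%:R / n%:R) (j%:R / n%:R)) => //.
    by rewrite pij.
  rewrite ix /= (le_trans (ltW xi)) // ler_wpM2r ?invr_ge0 ?ler0n //.
  by rewrite ler_nat.
rewrite -[leqRHS]card_ord; apply: (leq_card_in p) => i j Ai Aj pij.
apply/val_inj/eqP; rewrite eqn_leq leqNgt (sep _ _ Aj (esym pij)) /=.
by rewrite leqNgt (sep _ _ Ai pij).
Qed.

(** Error of the Riemann sum on one cell: both [(y - x) * v] and [(y - x) * e] are integrals of
    constants, so the bound is the triangle inequality for integrals. *)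
Lemma Rintegral_sub_cst {R : realType} {h : R -> R} {x y v e : R} : x <= y ->
  lebesgue_measure.-integrable `[x, y[ (EFin \o h) ->
  (forall t, t \in `[x, y[ -> `|h t - v| <= e) ->
  `|\int[lebesgue_measure]_(t in `[x, y[) h t - (y - x) * v| <= (y - x) * e.
Proof.
move=> lexy hint hve.
have muJ : lebesgue_measure (`[x, y[ : set R) = (y - x)%:E.
  rewrite lebesgue_measure_itv /= lte_fin.
  by case: ltgtP lexy => // -> _; rewrite subrr.
have cint (w : R) : lebesgue_measure.-integrable `[x, y[ (EFin \o cst w).
  apply: measurable_bounded_integrable => //.
  - by rewrite [ltLHS]muJ ltry.
  - exact: bounded_cst.
have -> : (y - x) * v = \int[lebesgue_measure]_(t in `[x, y[) v.
  by rewrite Rintegral_cst // [fine _](congr1 fine muJ) mulrC.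
have -> : (y - x) * e = \int[lebesgue_measure]_(t in `[x, y[) e.
  by rewrite Rintegral_cst // [fine _](congr1 fine muJ) mulrC.
rewrite -RintegralB //; last exact: cint.
have hvint : lebesgue_measure.-integrable `[x, y[ (EFin \o (fun t => h t - v)).
  by exact: (integrableB _ hint (cint v)).
apply: le_trans (le_normr_Rintegral _ hvint) _ => //.
apply: le_Rintegral => //.
- exact: integrable_norm hvint.
- exact: cint.
Qed.

(** The one-cell errors add up. The bound [e] depends on the cell, so that cells where [h] is
    constant can be given error [0]. *)
Lemma riemann_sum_error {R : realType} {h : R -> R} {n : nat} {e : nat -> R} :
  (0 < n)%N -> lebesgue_measure.-integrable `[0, 1] (EFin \o h) ->
  (forall i t, (i < n)%N -> t \in `[i%:R / n%:R, i.+1%:R / n%:R[ ->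
    `|h t - h (i%:R / n%:R)| <= e i) ->
  `|\int[lebesgue_measure]_(t in `[0, 1]) h t -
    n%:R^-1 * \sum_(i < n) h (i%:R / n%:R)| <= n%:R^-1 * \sum_(i < n) e i.
Proof.
move=> n0 hint he.
have nn : n%:R != 0 :> R by rewrite pnatr_eq0 -lt0n.
have sub01 (x y : R) : x \in `[0, 1] -> y \in `[0, 1] -> (`[x, y[ `<=` `[0, 1])%classic.
  rewrite !in_itv /= => /andP[x0 _] /andP[_ y1] t /=; rewrite !in_itv /= => /andP[xt ty].
  by rewrite (le_trans x0 xt) (le_trans (ltW ty) y1).
have hintS (x y : R) : x \in `[0, 1] -> y \in `[0, 1] ->
    lebesgue_measure.-integrable `[x, y[ (EFin \o h).
  by move=> x01 y01; apply: integrableS hint => //; exact: sub01.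
have z01 : 0 \in `[0 : R, 1] by rewrite in_itv /= lexx ler01.
have o01 : 1 \in `[0 : R, 1] by rewrite in_itv /= lexx ler01.
(* Induction on the number [m] of cells, the mesh [1 / n] staying fixed. At [m = n] only the null
   set [{1}] separates the domain from [[0, 1]]. *)
suff main m : (m <= n)%N ->
    `|\int[lebesgue_measure]_(t in `[0, m%:R / n%:R[) h t -
      n%:R^-1 * \sum_(i < m) h (i%:R / n%:R)| <= n%:R^-1 * \sum_(i < m) e i.
  by have := main n (leqnn n); rewrite divff // Rintegral_itv_bndo_bndc //; exact: hintS.
elim: m => [|m IHm] ltmn.
  by rewrite !big_ord0 mul0r set_itvco0 Rintegral_set0 !mulr0 subrr normr0.
have {}IHm := IHm (ltnW ltmn).
have m01 := @grid_in01 R _ _ (ltnW ltmn); have m1 := @grid_in01 R _ _ ltmn.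
have lemm : m%:R / n%:R <= m.+1%:R / n%:R :> R.
  by rewrite ler_wpM2r ?invr_ge0 ?ler0n // ler_nat.
have U : (`[0, m%:R / n%:R[ `|` `[m%:R / n%:R, m.+1%:R / n%:R[)%classic
         = `[0 : R, m.+1%:R / n%:R[%classic.
  by rewrite -itv_bndbnd_setU ?bnd_simp.
rewrite -U Rintegral_setU //; last 2 first.
- by rewrite U; exact: hintS.
- apply: lt_disjoint => x y; rewrite !in_itv /= => /andP[_ xm] /andP[my _].
  exact: lt_le_trans my.
rewrite !big_ord_recr /= !mulrDr opprD addrACA.
apply: (le_trans (ler_normD _ _)); apply: lerD => //.
have := Rintegral_sub_cst lemm (hintS _ _ m01 m1) (fun t => he m t ltmn).
by rewrite -mulrBl -natrB // subSnn mul1r.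
Qed.

Lemma sqr_vec_dist {R : realType} (n : nat) (f g : R -> R) :
  euclidean_norm (vec n f - vec n g) ^+ 2 =
  n%:R^-1 * \sum_(i < n) (f (i%:R / n%:R) - g (i%:R / n%:R)) ^+ 2.
Proof.
rewrite sqr_sqrtr; last by apply: sumr_ge0 => i _; exact: sqr_ge0.
rewrite mulr_sumr; apply: eq_bigr => i _.
by rewrite !mxE -mulrBr exprMn exprVn sqr_sqrtr ?ler0n.
Qed.

Lemma sqr_sub_itv {R : realType} {a b x y : R} :
  x \in `[a, b] -> y \in `[a, b] -> (x - y) ^+ 2 <= (b - a) ^+ 2.
Proof.
rewrite !in_itv /= => /andP[? ?] /andP[? ?].
by rewrite -subr_ge0 subr_sqr mulr_ge0 //; lra.
Qed.

Lemma step_sqr_dist_integrable {R : realType} {a b : R} {k l : nat} {f g : R -> R} :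
  set_fun `[0, 1] `[a, b] f -> set_fun `[0, 1] `[a, b] g ->
  step_function k f -> step_function l g ->
  lebesgue_measure.-integrable `[0, 1] (EFin \o (fun x => (f x - g x) ^+ 2)).
Proof.
move=> hf hg hfk hgl; apply: measurable_bounded_integrable => //.
- by rewrite /= lebesgue_measure_itv /= lte01 oppr0 adde0 ltry.
- apply: measurable_realfun.measurable_funX; apply: measurable_realfun.measurable_funB; [exact: step_function_measurable hfk|exact: step_function_measurable hgl].
- exists ((b - a) ^+ 2); split; first exact: num_real.
  move=> M ltM x x01; apply: (le_trans _ (ltW ltM)).
  by rewrite ger0_norm ?sqr_ge0 //; exact: sqr_sub_itv (hf x x01) (hg x x01).
Qed.

Lemma step_vec_error {R : realType} {a b : R} {k n : nat} {f g : R -> R} :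
  (0 < n)%N ->
  set_fun `[0, 1] `[a, b] f -> set_fun `[0, 1] `[a, b] g ->
  step_function k f -> step_function k g ->
  `|L2dist f g ^+ 2 - euclidean_norm (vec n f - vec n g) ^+ 2|
    <= 2 * k%:R * (b - a) ^+ 2 / n%:R.
Proof.
move=> n0 hf hg hfk hgk.
have hint := step_sqr_dist_integrable hf hg hfk hgk.
rewrite sqr_vec_dist sqr_sqrtr; last by apply: Rintegral_ge0 => x _; exact: sqr_ge0.
pose A := nonconstant_cells n f; pose B := nonconstant_cells n g.
(* A cell is charged [(b - a) ^+ 2] once for [A] and once for [B]; the double charge on [A :&: B]
   lets the sum split as [#|A| + #|B|]. The [exists] extends membership from ['I_n] to all natural
   numbers. *)
pose e (i : nat) : R := (b - a) ^+ 2 *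
  ([exists j in A, val j == i]%:R + [exists j in B, val j == i]%:R).
have inA (C : {set 'I_n}) (i : 'I_n) : [exists j in C, val j == val i] = (i \in C).
  by apply/exists_inP/idP => [[j Cj /eqP/val_inj<-]//|Ci]; exists i.
apply: (le_trans (riemann_sum_error (e := e) n0 hint _)).
  move=> i t ltin tcell; have := inA _ (Ordinal ltin); rewrite /e /= => inA'.
  rewrite !inA'.
  have lo : `[0 : R, 1]%classic (i%:R / n%:R) by exact/grid_in01/ltnW.
  have to : `[0 : R, 1]%classic t.
    have := @grid_in01 R n i.+1 ltin; move: lo tcell; rewrite /= !in_itv /=.
    by move=> /andP[? ?] /andP[? ?] /andP[? ?]; lra.
  have cA : Ordinal ltin \notin A -> f t = f (i%:R / n%:R).
    by rewrite inE => /asboolPn/forall2NP/(_ t)[//|/contrapT].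
  have cB : Ordinal ltin \notin B -> g t = g (i%:R / n%:R).
    by rewrite inE => /asboolPn/forall2NP/(_ t)[//|/contrapT].
  (* Both squares lie between [0] and [(b - a) ^+ 2], so their difference costs this amount only
     once. *)
  have osc : `|(f t - g t) ^+ 2 - (f (i%:R / n%:R) - g (i%:R / n%:R)) ^+ 2|
             <= (b - a) ^+ 2.
    have := sqr_sub_itv (hf _ lo) (hg _ lo); have := sqr_sub_itv (hf _ to) (hg _ to).
    have := sqr_ge0 (f t - g t); have := sqr_ge0 (f (i%:R / n%:R) - g (i%:R / n%:R)).
    by rewrite ler_norml; lra.
  have [Ai|/cA ft] := boolP (_ \in A).
    by apply: (le_trans osc); rewrite ler_peMr ?sqr_ge0 // lerDl ler0n.
  have [Bi|/cB gt] := boolP (_ \in B).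
    by apply: (le_trans osc); rewrite ler_peMr ?sqr_ge0 // lerDr ler0n.
  by rewrite ft gt subrr normr0 addr0 mulr0.
have -> : \sum_(i < n) e i = (b - a) ^+ 2 * (#|A| + #|B|)%:R.
  rewrite -mulr_sumr natrD big_split /=; congr (_ * (_ + _));
    rewrite -sum1_card natr_sum [RHS]big_mkcond /=;
    by apply: eq_bigr => i _; rewrite inA; case: (i \in _).
rewrite [leLHS]mulrC ler_wpM2r ?invr_ge0 ?ler0n // mulrC ler_wpM2r ?sqr_ge0 //.
rewrite -natrM ler_nat mul2n -addnn leq_add //; exact: card_nonconstant_cells.
Qed.

Theorem theoremB1 (R : realType) (a b r c : R) (k : nat) (f g : R -> R)
  (hab : a < b) (hr : 0 < r) (hc : 1 < c)
  (hf : set_fun `[0, 1] `[a, b] f) (hg : set_fun `[0, 1] `[a, b] g)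
  (hfk : step_function k f) (hgk : step_function k g)
  (n : nat)
  (hn : (2 * k%:R * (b - a) ^+ 2) / ((Num.sqrt c - 1) * r ^+ 2) <= n%:R) :
  (L2dist f g <= r ->
    euclidean_norm (vec n f - vec n g) <= c `^ (1 / 4) * r) /\
  (c * r < L2dist f g ->
    c `^ (3 / 4) * r < euclidean_norm (vec n f - vec n g)).
Proof.
(* Zero pieces cannot cover the point [0]. Positivity of [k] makes the threshold in [hn] positive,
   which forces [0 < n]. *)
have k0 : (0 < k)%N.
  case: k hfk {hgk hn} => // -[I [[Icov _ _] _ _]].
  have : `[0 : R, 1]%classic 0 by rewrite /= in_itv /= lexx ler01.
  by rewrite -Icov => -[[]].
have r0 : 0 <= r := ltW hr.
have c0 : 0 < c by exact: lt_trans hc.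
set s := Num.sqrt c in hn.
have s1 : 1 < s by rewrite -[ltLHS]sqrtr1 ltr_sqrt.
have sE : s ^+ 2 = c by rewrite sqr_sqrtr // ltW.
have D0 : 0 < (s - 1) * r ^+ 2 by rewrite mulr_gt0 ?exprn_gt0 // subr_gt0.
have N0 : 0 < 2 * k%:R * (b - a) ^+ 2.
  by rewrite !mulr_gt0 ?exprn_gt0 ?ltr0n // subr_gt0.
have n0 : (0 < n)%N by rewrite -(ltr0n R); exact: lt_le_trans (divr_gt0 N0 D0) hn.
have err : `|L2dist f g ^+ 2 - euclidean_norm (vec n f - vec n g) ^+ 2|
    <= (s - 1) * r ^+ 2.
  apply: le_trans (step_vec_error n0 hf hg hfk hgk) _.
  by rewrite ler_pdivrMr ?ltr0n // -ler_pdivrMl // mulrC.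
(* After squaring, both claims become polynomial inequalities in [s] and [r], with [c = s ^+ 2]. *)
have q1 : (c `^ (1 / 4)) ^+ 2 = s.
  rewrite -powR_mulrn ?powR_ge0 // -powRrM.
  by rewrite (_ : 1 / 4 * 2%:R = 2^-1) ?powR12_sqrt ?ltW //; field.
have q3 : (c `^ (3 / 4)) ^+ 2 = s ^+ 3.
  rewrite (_ : 3 / 4 = 1 / 4 * 3%:R); last by field.
  by rewrite powRrM powR_mulrn ?powR_ge0 // exprAC q1.
move: err; rewrite ler_norml => /andP[lo hi].
have E0 : 0 <= euclidean_norm (vec n f - vec n g) by exact: sqrtr_ge0.
have L0 : 0 <= L2dist f g by exact: sqrtr_ge0.
split=> [Lr|Lcr].
- rewrite -(@ler_pXn2r _ 2) ?nnegrE ?mulr_ge0 ?powR_ge0 // exprMn q1.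
  (* The error adds up to exactly the allowed square: [r ^+ 2 + (s - 1) * r ^+ 2 = s * r ^+ 2]. *)
  have : L2dist f g ^+ 2 <= r ^+ 2 by rewrite ler_pXn2r // nnegrE ltW.
  lra.
- rewrite -(@ltr_pXn2r _ 2) ?nnegrE ?mulr_ge0 ?powR_ge0 // exprMn q3.
  (* The left side is [s ^+ 4 * r ^+ 2], so the squared norm exceeds [(s ^+ 4 - (s - 1)) * r ^+ 2],
     to be compared with [s ^+ 3 * r ^+ 2]. *)
  have : (c * r) ^+ 2 < L2dist f g ^+ 2.
    by rewrite ltr_pXn2r // nnegrE mulr_ge0 // ltW.
  (* [s ^+ 4 - s ^+ 3 - (s - 1) = (s - 1) * (s ^+ 3 - 1)] *)
  have : 0 < (s - 1) * (s ^+ 3 - 1) * r ^+ 2.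
    by rewrite !mulr_gt0 ?exprn_gt0 // subr_gt0 // exprn_egt1.
  rewrite exprMn -sE; lra.
Qed.
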